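(* Fix $n$, $t$, and a corruption type $\tau\in\{\text{send-omission},\ \text{Byzantine},\ \text{authenticated Byzantine}\}$. If binary Commit-Adopt is solvable against a mobile $t$-MAd adversary of type $\tau$, then binary consensus is solvable against a stationary $t$-MAd adversary of type $\tau$.
   Context: System: $n$ processors $p_1,\dots,p_n$ run a synchronous protocol in rounds; in each round every processor sends a (possibly different) message to every processor over a dedicated point-to-point channel whose receiver knows which processor the channel comes from, and all messages sent in round $\rho$ are delivered by the beginning of round $\rho+1$. A message adversary (MAd) sees all messages and, in each round, may act only on the outgoing messages of the processors it corrupts in that round; it never alters processors' internal states, inputs, outputs or incoming messages. Every processor (corrupted or not) must produce an output, and the task's output conditions apply to all processors. Corruption types: send-omission (the adversary may delete any of the messages sent by a processor corrupted in that round); Byzantine (it may delete or replace arbitrarily any message sent by a processor corrupted in that round); authenticated Byzantine (as Byzantine, but every message has the form $(p_i,\rho,m)$, and for every message $(p,\rho,m)$ sent in the protocol and every $(p',\rho',m')$ with $\rho'\le\rho$ encoded as a substring of $m$, either $p'$ was corrupted in round $\rho'$ or $p'$ was uncorrupted in round $\rho'$ and actually sent $(p',\rho',m')$). A stationary $t$-MAd adversary corrupts at most $t$ processors in total throughout the execution; a mobile $t$-MAd adversary corrupts at most $t$ processors in each round, possibly a different set each round. A task is solvable against an adversary if some protocol guarantees, for every input assignment and every admissible adversary behavior, that every processor outputs and the outputs satisfy the task. Binary consensus: each processor has an input bit and outputs a bit; every output equals some processor's input, and no two processors output different bits. Binary Commit-Adopt (CA): each processor $p_i$ has an input bit $v_i$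 and outputs $commit(v)$ or $adopt(v)$ where $v$ is some processor's input; (1) if all inputs equal $v$ then all output $commit(v)$; (2) if some processor outputs $commit(v)$ then every processor outputs $commit(v)$ or $adopt(v)$. *)

(* Defs.v *)
(* Mathematical Components *)
From mathcomp Require Import all_boot.

Set Implicit Arguments.
Unset Strict Implicit.
Unset Printing Implicit Defensive.

(* Messages are finite strings.  The letter [None] is a marker opening an
   encoded triple and [Some k] is the number [k].  Since the length of the
   payload is part of the header, at most one encoded triple starts at any
   given position of a string. *)
Definition message := seq (option nat).

Definition encode (n : nat) (p : 'I_n) (r : nat) (m : message) : message :=
  [:: None; Some (nat_of_ord p); Some r; Some (size m)] ++ m.

(* Deterministic synchronous protocols with binary inputs.  A local state may
   contain the identity of the processor and the current round.  In
   [receive s f], [f p] is what arrives on the channel from [p], [None] meaning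
   that nothing does. *)
Record protocol (n : nat) (O : Type) : Type := Protocol {
  state : Type;
  init : 'I_n -> bool -> state;
  send : state -> 'I_n -> message;
  receive : state -> ('I_n -> option message) -> state;
  output : state -> option O
}.

(* Rounds are numbered from 0. [d r p q] is what [p] puts, after the
   intervention of the adversary, on its channel to [q] in round [r]. *)
Definition traffic (n : nat) := nat -> 'I_n -> 'I_n -> option message.

(* [F r] is the set of processors corrupted in round [r]. *)
Definition corruption_pattern (n : nat) := nat -> {set 'I_n}.

Definition mobile (n t : nat) (F : corruption_pattern n) : Prop :=
  forall r, #|F r| <= t.

Definition stationary (n t : nat) (F : corruption_pattern n) : Prop :=
  exists2 S : {set 'I_n}, #|S| <= t & forall r, F r \subset S.

Inductive corruption := SendOmission | Byzantine | AuthByzantine.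

(* The string [s], sent by [p] in round [r], has the form (p, r, m), and the
   triples occurring in [m] are not forged. *)
Definition authentic (n : nat) (F : corruption_pattern n) (d : traffic n)
    (r : nat) (p : 'I_n) (s : message) : Prop :=
  exists2 m : message, s = encode p r m &
    forall (p' : 'I_n) (r' : nat) (m' : message),
      r' <= r -> infix (encode p' r' m') m ->
      p' \in F r' \/
      (p' \notin F r' /\ exists q, d r' p' q = Some (encode p' r' m')).

Section Executions.

Variables (n : nat) (O : Type) (P : protocol n O).

(* The local state of [p] at the beginning of round [r]. *)
Fixpoint state_at (x : 'I_n -> bool) (d : traffic n) (r : nat) (p : 'I_n)
    : state P :=
  if r is r'.+1 then receive (state_at x d r' p) (fun q => d r' q p)
  else init P p (x p).

Definition sent_by_protocol (x : 'I_n -> bool) (d : traffic n) (r : nat)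
    (p q : 'I_n) : message :=
  send (state_at x d r p) q.

(* What the adversary may do to the channels of a corrupted processor. *)
Definition allowed (tau : corruption) (x : 'I_n -> bool)
    (F : corruption_pattern n) (d : traffic n) (r : nat) (p q : 'I_n) : Prop :=
  match tau with
  | SendOmission =>
      d r p q = None \/ d r p q = Some (sent_by_protocol x d r p q)
  | Byzantine => True
  | AuthByzantine => forall s, d r p q = Some s -> authentic F d r p s
  end.

(* As protocols are deterministic, quantifying over all the executions
   accounts for every strategy, adaptive or not, of the adversary. *)
Definition execution (tau : corruption) (x : 'I_n -> bool)
    (F : corruption_pattern n) (d : traffic n) : Prop :=
  forall r p q,
    if p \in F r then allowed tau x F d r p q
    else d r p q = Some (sent_by_protocol x d r p q).

(* The authenticity condition bears on all messages, hence also on those of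
   the uncorrupted processors.  For these it is an obligation on the protocol:
   making it a hypothesis on executions instead would let a protocol that
   forges messages have no execution at all, and so solve any task. *)
Definition conforms (tau : corruption) (F : corruption_pattern n)
    (d : traffic n) : Prop :=
  if tau is AuthByzantine then
    forall r p q s, d r p q = Some s -> authentic F d r p s
  else True.

(* A processor outputs once: later values of [output] are ignored. *)
Definition outputs (x : 'I_n -> bool) (d : traffic n) (p : 'I_n) (o : O)
    : Prop :=
  exists2 r, output (state_at x d r p) = Some o &
    forall r', r' < r -> output (state_at x d r' p) = None.

End Executions.

Definition task (n : nat) (O : Type) := ('I_n -> bool) -> ('I_n -> O) -> Prop.

Definition solvable (n : nat) (O : Type) (tau : corruption)
    (budget : corruption_pattern n -> Prop) (T : task n O) : Prop :=
  exists P : protocol n O,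
    forall (x : 'I_n -> bool) (F : corruption_pattern n) (d : traffic n),
      budget F -> execution P tau x F d ->
      conforms tau F d /\
      exists2 y : 'I_n -> O, (forall p, outputs P x d p (y p)) & T x y.

Definition consensus (n : nat) : task n bool := fun x y =>
  (forall i, exists j, y i = x j) /\ (forall i j, y i = y j).

Inductive ca_output := Commit of bool | Adopt of bool.

Definition commit_adopt (n : nat) : task n ca_output := fun x y =>
  [/\ forall i, exists j, y i = Commit (x j) \/ y i = Adopt (x j),
      forall v, (forall i, x i = v) -> forall i, y i = Commit v
    & forall i v, y i = Commit v ->
        forall j, y j = Commit v \/ y j = Adopt v].

(* Main.v *)
(** Commit-Adopt cannot simply be iterated with rotating
    coordinators: since messages range over an infinite set, a protocol that
    always terminates need not do so within a bounded number of rounds, so that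
    phases cannot be synchronized.  Instead, solvability of Commit-Adopt is
    shown to bound [t] (when [n > 1]): [t < n] for send omissions, [3t < n] in
    the Byzantine case and [2t < n] in the authenticated one, by
    indistinguishability from two executions with constant inputs.  Under these
    bounds consensus is solved directly, by a rotating coordinator, by the
    phase king algorithm, and by a broadcast of signed votes in the style of
    Dolev and Strong, respectively.

    In the last one, even rounds carry votes and odd rounds relay all the votes
    seen, so that signed messages are never nested more than once.  In phase
    [j > 0] a processor votes if it knows more than [t] initial votes for
    [true] and [j - 1] later votes of distinct processors; the decision is
    whether to vote in phase [t + 2]. *)
Require Import Defs.
From Stdlib Require Import FunctionalExtensionality.
From mathcomp Require Import all_boot zify.

Set Implicit Arguments.
Unset Strict Implicit.
Unset Printing Implicit Defensive.

(** * Lower bounds from Commit-Adopt *)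

Definition solves (n : nat) (O : Type) (tau : corruption)
    (budget : corruption_pattern n -> Prop) (T : task n O)
    (P : protocol n O) : Prop :=
  forall (x : 'I_n -> bool) (F : corruption_pattern n) (d : traffic n),
    budget F -> execution P tau x F d ->
    conforms tau F d /\
    exists2 y : 'I_n -> O, (forall p, outputs P x d p (y p)) & T x y.

Lemma outputs_inj n O (P : protocol n O) x d x' d' p o o' :
  (forall r, state_at P x d r p = state_at P x' d' r p) ->
  outputs P x d p o -> outputs P x' d' p o' -> o = o'.
Proof.
move=> same [r out_r before_r] [r' out_r' before_r'].
case: (ltngtP r r') => [lt_rr'|lt_r'r|eq_rr'].
- by move: out_r; rewrite same before_r'.
- by move: out_r'; rewrite -same before_r.
- by move: out_r; rewrite same eq_rr' out_r' => -[].
Qed.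

(** Constant inputs force commitment: in the single execution [d], [p] would commit to [false] and
    [q] to [true]. *)
Lemma indistinguishable_contradiction n t tau (P : protocol n ca_output)
    x F d x' F' d' x'' F'' d'' p q :
  solves tau (@mobile n t) (@commit_adopt n) P ->
  mobile t F -> execution P tau x F d ->
  mobile t F' -> execution P tau x' F' d' -> (forall i, x' i = false) ->
  mobile t F'' -> execution P tau x'' F'' d'' -> (forall i, x'' i = true) ->
  (forall r, state_at P x d r p = state_at P x' d' r p) ->
  (forall r, state_at P x d r q = state_at P x'' d'' r q) ->
  False.
Proof.
move=> solP mF exF mF' exF' x0 mF'' exF'' x1 same_p same_q.
have [_ [y out_y [_ _ agree]]] := solP _ _ _ mF exF.
have [_ [y' out_y' [_ commit_y' _]]] := solP _ _ _ mF' exF'.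
have [_ [y'' out_y'' [_ commit_y'' _]]] := solP _ _ _ mF'' exF''.
have yp : y p = Commit false.
  rewrite (outputs_inj same_p (out_y p) (out_y' p)); exact: commit_y'.
have yq : y q = Commit true.
  rewrite (outputs_inj same_q (out_y q) (out_y'' q)); exact: commit_y''.
by case: (agree p false yp q); rewrite yq.
Qed.

Lemma card_interval n a b : #|[set i : 'I_n | a <= i < b]| <= b - a.
Proof.
rewrite cardE -(size_map val) -[X in _ <= X](size_iota a).
apply: uniq_leq_size; first by rewrite map_inj_uniq ?enum_uniq //; exact: val_inj.
move=> i /mapP[j]; rewrite mem_enum inE => lt_j ->.
by rewrite mem_iota /=; lia.
Qed.

(** If [n <= t], every message can be deleted, so each processor sees only its own input. *)
Lemma omission_bound n t :
  1 < n -> solvable SendOmission (@mobile n t) (@commit_adopt n) -> t < n.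
Proof.
move=> gt1n [P solP]; rewrite ltnNge; apply/negP => le_nt.
pose F : corruption_pattern n := fun=> setT.
pose d : traffic n := fun _ _ _ => None.
have mF : mobile t F by move=> r; rewrite cardsT card_ord.
have exF x : execution P SendOmission x F d by move=> r p q; rewrite inE; left.
have lt0n : 0 < n by lia.
pose x (i : 'I_n) := 0 < i.
have same b p : x p = b ->
    forall r, state_at P x d r p = state_at P (fun=> b) d r p.
  by move=> xp; elim=> [|r IHr] /=; rewrite ?xp ?IHr.
exact: (indistinguishable_contradiction solP mF (exF x) mF (exF _) (fun=> erefl)
  mF (exF _) (fun=> erefl) (same false (Ordinal lt0n) erefl)
  (same true (Ordinal gt1n) erefl)).
Qed.

Lemma authentic_monotone n (F F' : corruption_pattern n) d r p s :
  (forall r', F r' \subset F' r') -> authentic F d r p s -> authentic F' d r p s.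
Proof.
move=> sFF' [m -> real]; exists m => // p' r' m' le_r'r inf.
have [inF'|ninF'] := boolP (p' \in F' r'); [by left | right; split=> //].
have [inF|[]//] := real _ _ _ le_r'r inf.
by case/negP: ninF'; apply: (subsetP (sFF' r')).
Qed.

(** * Executions obtained from a double cover *)

Section TwoCopies.

Variables (n : nat) (O : Type) (P : protocol n O) (twist : 'I_n -> 'I_n -> bool).

(* The double cover of the complete graph determined by [twist]: copy [b] of
   [q], which starts with input [b], listens to copy [b (+) twist p q] of
   [p]. *)
Fixpoint cover_state (r : nat) (b : bool) (q : 'I_n) : state P :=
  if r is r'.+1 then
    receive (cover_state r' b q)
      (fun p => Some (send (cover_state r' (b (+) twist p q) p) q))
  else init P q b.

(** [g p q] tells which copy of [p] is shown to [q]; under [g_out] below, only a corrupted [p] can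
    show both. *)
Definition cover_traffic (g : 'I_n -> 'I_n -> bool) : traffic n :=
  fun r p q => Some (send (cover_state r (g p q) p) q).

Variables (x : 'I_n -> bool) (g : 'I_n -> 'I_n -> bool) (H : {set 'I_n}).
Hypothesis g_in : forall p q, q \in H -> g p q = x q (+) twist p q.
Hypothesis g_out : forall p q, p \in H -> g p q = x p.

Lemma state_at_cover r q :
  q \in H -> state_at P x (cover_traffic g) r q = cover_state r (x q) q.
Proof.
elim: r q => [|r IHr] q qH //=; rewrite IHr //.
have -> : (fun p => cover_traffic g r p q) =
  (fun p => Some (send (cover_state r (x q (+) twist p q) p) q)).
  by apply: functional_extensionality => p; rewrite /cover_traffic g_in.
by [].
Qed.

Lemma execution_cover tau :
  tau <> SendOmission ->
  (tau = AuthByzantine -> forall r p q s, p \notin H ->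
     cover_traffic g r p q = Some s -> authentic (fun=> ~: H) (cover_traffic g) r p s) ->
  execution P tau x (fun=> ~: H) (cover_traffic g).
Proof.
move=> not_omission auth r p q; rewrite inE.
have [pH|pH] /= := boolP (p \in H).
  by rewrite /sent_by_protocol state_at_cover // /cover_traffic g_out.
by case: tau not_omission auth => //= _ auth s; apply: auth.
Qed.

End TwoCopies.

(* The processors are split into [A = [0, a)], [B = [a, c)] and [C = [c, n)],
   and the two copies are exchanged between [A] and [C] only.  When [B] is
   empty, the three executions have the same traffic, hence are all authentic
   as soon as the first one, where nobody is corrupted, is. *)
Lemma cover_contradiction n t a c tau :
  0 < a -> a <= c -> c < n -> a <= t -> c - a <= t -> n - c <= t ->
  tau <> SendOmission -> (tau = AuthByzantine -> a = c) ->
  ~ solvable tau (@mobile n t) (@commit_adopt n).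
Proof.
move=> gt0a le_ac lt_cn le_at le_B le_C not_omission auth_B [P solP].
pose inA (i : 'I_n) := i < a; pose inC (i : 'I_n) := c <= i.
pose twist p q := inA p && inC q || inC p && inA q.
(* The value [inA p] between corrupted processors makes the three traffics coincide when [B] is
   empty. *)
pose g (H : {set 'I_n}) (x : 'I_n -> bool) p q :=
  if q \in H then x q (+) twist p q else if p \in H then x p else inA p.
have AC i : ~~ (inA i && inC i) by rewrite /inA /inC; lia.
(* [B] is corrupted when exactly [A] has input [true], [A] when all inputs are [false], [C] when all
   are [true]. *)
pose H := [set i | inA i || inC i].
pose H0 := [set i | ~~ inA i]; pose H1 := [set i | ~~ inC i].
pose x0 := fun _ : 'I_n => false; pose x1 := fun _ : 'I_n => true.
have g_in (K : {set 'I_n}) x p q : q \in K -> g K x p q = x q (+) twist p q.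
  by rewrite /g => ->.
have g_out p q : p \in H -> g H inA p q = inA p.
  rewrite /g /twist !inE; move: (AC p) (AC q).
  by case: (inA p); case: (inA q); case: (inC p); case: (inC q).
have g_out0 p q : p \in H0 -> g H0 x0 p q = x0 p.
  rewrite /g /twist !inE; move: (AC p) (AC q).
  by case: (inA p); case: (inA q); case: (inC p); case: (inC q).
have g_out1 p q : p \in H1 -> g H1 x1 p q = x1 p.
  rewrite /g /twist !inE; move: (AC p) (AC q).
  by case: (inA p); case: (inA q); case: (inC p); case: (inC q).
have mob u v (K : {set 'I_n}) : v - u <= t ->
    (forall i, i \notin K -> u <= i < v) -> mobile t (fun=> ~: K).
  move=> le_t sub r; apply: leq_trans le_t; apply: leq_trans (card_interval n u v).
  by apply/subset_leq_card/subsetP => i; rewrite !inE; apply: sub.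
have mB : mobile t (fun=> ~: H).
  by apply: (mob a c) => // i; rewrite inE /inA /inC; lia.
have mA : mobile t (fun=> ~: H0).
  by apply: (mob 0 a) => [|i]; rewrite ?inE /inA /inC; lia.
have mC : mobile t (fun=> ~: H1).
  by apply: (mob c n) => // i; rewrite inE /inA /inC; move: (ltn_ord i); lia.
have noB : a = c -> H = setT.
  by move=> eq_ac; apply/setP=> i; rewrite !inE /inA /inC; lia.
have exB : execution P tau inA (fun=> ~: H)
    (cover_traffic P twist (g H inA)).
  apply: execution_cover => // [p q|/auth_B/noB-> r p q s]; first exact: g_in.
  by rewrite inE.
have ex K x (mK : mobile t (fun=> ~: K)) :
    (forall p q, p \in K -> g K x p q = x p) ->
    (a = c -> forall p q, g K x p q = inA p) ->
    execution P tau x (fun=> ~: K) (cover_traffic P twist (g K x)).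
  move=> g_outK gA; apply: execution_cover => // [p q|]; first exact: g_in.
  move=> tauE r p q s _ dE; have eq_ac := auth_B tauE.
  have [cB _] := solP _ _ _ mB exB; rewrite tauE /= in cB.
  have eq_d : cover_traffic P twist (g K x) = cover_traffic P twist (g H inA).
    apply: functional_extensionality => r'; apply: functional_extensionality => p'.
    apply: functional_extensionality => q'; rewrite /cover_traffic gA //.
    by rewrite g_out // noB.
  rewrite eq_d in dE *; apply: authentic_monotone (cB _ _ _ _ dE) => _.
  by rewrite noB // setCT sub0set.
have ex0 : execution P tau x0 (fun=> ~: H0) (cover_traffic P twist (g H0 x0)).
  apply: ex => // eq_ac p q; rewrite /g /twist !inE /x0.
  have Cn i : inC i = ~~ inA i by rewrite /inA /inC; lia.
  by rewrite !Cn; case: (inA p); case: (inA q).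
have ex1 : execution P tau x1 (fun=> ~: H1) (cover_traffic P twist (g H1 x1)).
  apply: ex => // eq_ac p q; rewrite /g /twist !inE /x1.
  have Cn i : inC i = ~~ inA i by rewrite /inA /inC; lia.
  by rewrite !Cn; case: (inA p); case: (inA q).
have lt0n : 0 < n by lia.
pose i0 := Ordinal lt0n; pose ic := Ordinal lt_cn.
have A0 : inA i0 by [].
have Cc : inC ic by rewrite /inC /=.
have nAc : ~~ inA ic by rewrite /inA /=; lia.
have nC0 : ~~ inC i0 by rewrite /inC /=; lia.
have view (K : {set 'I_n}) x r q : q \in K ->
    state_at P x (cover_traffic P twist (g K x)) r q
    = cover_state P twist r (x q) q.
  by move=> qK; apply: state_at_cover qK => p q'; apply: g_in.
(* [C] cannot tell the first execution from the all-[false] one, nor [A] from the all-[true] one. *)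
apply: (indistinguishable_contradiction (p := ic) (q := i0) solP
  mB exB mA ex0 _ mC ex1) => // r.
- by rewrite !view ?inE ?Cc ?orbT // (negbTE nAc).
- by rewrite !view ?inE ?A0.
Qed.

Lemma auth_bound n t :
  1 < n -> solvable AuthByzantine (@mobile n t) (@commit_adopt n) -> 2 * t < n.
Proof.
move=> gt1n solv; rewrite ltnNge; apply/negP => le_n2t.
by apply: (@cover_contradiction n t n./2 n./2 _ _ _ _ _ _ _ _ _ solv) => //; lia.
Qed.

Lemma byzantine_bound n t :
  1 < n -> solvable Byzantine (@mobile n t) (@commit_adopt n) -> 3 * t < n.
Proof.
move=> gt1n solv; rewrite ltnNge; apply/negP => le_n3t.
(* For [n <= 2 * t], taking [a = t] and [c = n - t] could violate [a <= c]; two halves with [B]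
   empty serve instead. *)
have [le_n2t|lt_2tn] := leqP n (2 * t).
  by apply: (@cover_contradiction n t n./2 n./2 _ _ _ _ _ _ _ _ _ solv) => //; lia.
by apply: (@cover_contradiction n t t (n - t) _ _ _ _ _ _ _ _ _ solv) => //; lia.
Qed.

(** * Consensus under send omissions *)

(* [T] is the part of the local state besides the current round and the
   identity of the processor. *)
Definition timed n T (ini : bool -> T) (snd : nat -> 'I_n -> T -> message)
    (rcv : nat -> T -> ('I_n -> option message) -> T) (R : nat)
    (out : T -> bool) : protocol n bool :=
  Protocol (state := nat * 'I_n * T) (fun p b => (0, p, ini b))
    (fun s _ => snd s.1.1 s.1.2 s.2)
    (fun s f => (s.1.1.+1, s.1.2, rcv s.1.1 s.2 f))
    (fun s => if s.1.1 == R then Some (out s.2) else None).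

Fixpoint timed_at n T (ini : bool -> T)
    (rcv : nat -> T -> ('I_n -> option message) -> T) (x : 'I_n -> bool)
    (d : traffic n) (r : nat) (p : 'I_n) : T :=
  if r is r'.+1 then rcv r' (timed_at ini rcv x d r' p) (fun q => d r' q p)
  else ini (x p).

Definition broadcast_execution n (tau : corruption) (F : corruption_pattern n)
    (d : traffic n) (msg : nat -> 'I_n -> message) : Prop :=
  forall r p q,
    if p \in F r then
      match tau with
      | SendOmission => d r p q = None \/ d r p q = Some (msg r p)
      | Byzantine => True
      | AuthByzantine => forall s, d r p q = Some s -> authentic F d r p s
      end
    else d r p q = Some (msg r p).

(** The clock makes every processor output in round [R], so termination is automatic. *)
Lemma timed_solvable n T ini snd rcv R (out : T -> bool) tau budget tsk :
  (forall x F d, budget F ->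
    let st := timed_at ini rcv x d in
    broadcast_execution tau F d (fun r p => snd r p (st r p)) ->
    conforms tau F d /\ tsk x (fun p => out (st R p))) ->
  @solvable n bool tau budget tsk.
Proof.
move=> spec; pose P := timed ini snd rcv R out; exists P => x F d bF ex.
have stE r p : state_at P x d r p = (r, p, timed_at ini rcv x d r p).
  by elim: r => [|r IHr] //=; rewrite IHr.
have [r p q|conf tsk_x] := spec x F d bF.
  have := ex r p q; rewrite /allowed /sent_by_protocol stE.
  by case: ifP => //; case: tau {spec ex}.
split=> //; exists (fun p => out (timed_at ini rcv x d R p)) => // p.
exists R; first by rewrite stE /= eqxx.
by move=> r ltrR; rewrite stE /= ltn_eqF.
Qed.

Definition bit_message (b : bool) : message := [:: Some (b : nat)].

Lemma encode_notin_bit n p r m b : ~~ infix (@encode n p r m) (bit_message b).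
Proof. by rewrite /= /encode /= ; case: b; case: m. Qed.

Lemma solvable_alone n tau budget : n <= 1 -> solvable tau budget (@consensus n).
Proof.
move=> le_n1.
apply: (@timed_solvable n bool id (fun r p _ => encode p r [::])
  (fun _ b _ => b) 0 id) => x F d bF st ex; split; last first.
  split=> [i|i j]; first by exists i.
  by congr x; apply: val_inj => /=; move: (ltn_ord i) (ltn_ord j); lia.
case: tau ex => //= ex r p q s dE; have := ex r p q.
case: ifP => [_ auth|_]; first exact: auth.
by rewrite dE => -[->]; exists [::] => // p' r' m' _; rewrite infixs0.
Qed.

(** For bits, an output that is nobody's input forces all inputs to be its negation, hence
    constant. *)
Lemma disagreeing_or_constant n (x y : 'I_n -> bool) :
  (forall i b, (forall j, x j = b) -> y i = b) ->
  forall i, exists j, y i = x j.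
Proof.
move=> valid i; case: (pickP [pred j | x j == y i]) => [j /eqP<-|none]; first by exists j.
have const j : x j = ~~ y i by have /= := none j; case: (x j); case: (y i).
by have := valid i _ const; case: (y i).
Qed.

Lemma exists_uncorrupted n (S : {set 'I_n}) t : #|S| <= t -> t < n -> exists k, k \notin S.
Proof.
move=> leSt lt_tn; case: (pickP [pred k | k \notin S]) => [k|all]; first by exists k.
have : S = setT by apply/setP => k; rewrite inE; have /= /negbFE := all k.
by move=> eqS; move: leSt; rewrite eqS cardsT card_ord; lia.
Qed.

(* Once an uncorrupted coordinator has been heard by all, later coordinators
   can only repeat the common value. *)
Lemma solvable_omission n t :
  t < n -> solvable SendOmission (@stationary n t) (@consensus n).
Proof.
move=> lt_tn.
pose rcv r (b : bool) (f : 'I_n -> option message) :=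
  if insub r is Some k then
    if f k is Some s then s == bit_message true else b
  else b.
apply: (@timed_solvable n bool id (fun r p b => bit_message b) rcv n id).
move=> x F d [S leS sFS] st ex; split=> //.
have bitE b : (bit_message b == bit_message true) = b by case: b.
(* A deletion makes [p] keep its bit, so every new bit is somebody's old one, whence validity. *)
have heard r p : exists2 q, st r.+1 p = st r q &
    forall k, insub r = Some k -> k \notin S -> q = k.
  have -> : st r.+1 p = rcv r (st r p) (fun q => d r q p) by [].
  rewrite /rcv; case: insubP => [k ltrn kr|_]; last by exists p.
  have := ex r k p; case: ifP => [inF [->|->]|_ ->].
  - by exists p => // _ [<-]; rewrite (subsetP (sFS r)).
  - by exists k => [|_ [<-]]; rewrite ?bitE.
  - by exists k => [|_ [<-]]; rewrite ?bitE.
have [k kS] := exists_uncorrupted leS lt_tn.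
have agree r p q : k < r -> st r p = st r q.
  elim: r p q => // r IHr p q; rewrite ltnS leq_eqVlt.
  have [p' -> p'P] := heard r p; have [q' -> q'P] := heard r q.
  case/predU1P=> [eq_kr|/(IHr p' q')//]; have rk : insub r = Some k by rewrite -eq_kr valK.
  by rewrite (p'P k) ?(q'P k).
split=> [i|i j]; last exact: agree (ltn_ord k).
have valid r p : exists j, st r p = x j.
  by elim: r p => [|r IHr] p; [exists p | have [q -> _] := heard r p].
exact: valid.
Qed.

(** * Phase king *)

Section PhaseKing.

Variables (n t : nat).

Definition choice_message (w : option bool) : message := [:: omap nat_of_bool w].

Definition voters (f : 'I_n -> option message) (b : bool) : {set 'I_n} :=
  [set p | f p == Some (choice_message (Some b))].

Record king_state := KingState {
  preference : bool;
  proposal : option bool;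
  locked : bool
}.

(* Phase [k] consists of rounds [3k], [3k+1] and [3k+2], in which the
   processors broadcast their preference, their proposal and their preference
   again; the last broadcast only matters as coming from the king [k]. *)
Definition king_send (r : nat) (p : 'I_n) (s : king_state) : message :=
  choice_message (if r %% 3 == 1 then proposal s else Some (preference s)).

(** Unanimous uncorrupted senders secure [n - t] votes; more than [t] votes include an uncorrupted
    one. A locked processor ignores the king. *)
Definition king_receive (r : nat) (s : king_state) (f : 'I_n -> option message)
    : king_state :=
  match r %% 3 with
  | 0 => KingState (preference s) [pick b | n - t <= #|voters f b|] (locked s)
  | 1 =>
      if [pick b | n - t <= #|voters f b|] is Some b then
        KingState b (proposal s) true
      else if [pick b | t < #|voters f b|] is Some b then
        KingState b (proposal s) false
      else KingState (preference s) (proposal s) false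
  | _ =>
      KingState
        (if locked s then preference s
         else if insub (r %/ 3) is Some k then
           f k == Some (choice_message (Some true))
         else preference s)
        (proposal s) (locked s)
  end.

Definition king_init (b : bool) := KingState b None false.

Variables (x : 'I_n -> bool) (S : {set 'I_n}) (d : traffic n).

Local Notation st := (timed_at king_init king_receive x d).

Hypothesis small_t : 3 * t < n.
Hypothesis card_S : #|S| <= t.
Hypothesis reliable :
  forall r p q, p \notin S -> d r p q = Some (king_send r p (st r p)).

Let received r p := fun q => d r q p.

Lemma timed_atS r p : st r.+1 p = king_receive r (st r p) (received r p).
Proof. by []. Qed.

Lemma king_receive0 k s f : king_receive (3 * k) s f =
  KingState (preference s) [pick b | n - t <= #|voters f b|] (locked s).
Proof. by rewrite /king_receive modnMr. Qed.

Lemma mod3S k : (3 * k).+1 %% 3 = 1.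
Proof. lia. Qed.

Lemma mod3SS k : (3 * k).+2 %% 3 = 2.
Proof. lia. Qed.

Lemma div3SS k : (3 * k).+2 %/ 3 = k.
Proof. lia. Qed.

Lemma voterE r p b a : a \notin S ->
  (a \in voters (received r p) b) =
  ((if r %% 3 == 1 then proposal (st r a) else Some (preference (st r a)))
    == Some b).
Proof.
move=> aS; rewrite inE /received reliable // /king_send.
by case: (if _ then _ else _) => [c|]; case: b => //; case: c.
Qed.

Lemma many_voters_honest r p b :
  t < #|voters (received r p) b| ->
  exists2 a, a \notin S & a \in voters (received r p) b.
Proof.
move=> many; have /subsetPn[a aV aS] : ~~ (voters (received r p) b \subset S).
  by apply/negP => /subset_leq_card; lia.
by exists a.
Qed.

Lemma unanimous_voters r p b :
  (forall a, a \notin S -> a \in voters (received r p) b) ->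
  n - t <= #|voters (received r p) b|.
Proof.
move=> all; have /subset_leq_card : ~: S \subset voters (received r p) b.
  by apply/subsetP => a; rewrite inE; apply: all.
have := cardsC S; rewrite card_ord; lia.
Qed.

(** The intersection has at least [n - 2 * t > t] elements. *)
Lemma large_sets_meet (X Y : {set 'I_n}) :
  n - t <= #|X| -> n - t <= #|Y| -> exists2 a, a \notin S & a \in X :&: Y.
Proof.
move=> leX leY; have /subsetPn[a aXY aS] : ~~ (X :&: Y \subset S).
  apply/negP => /subset_leq_card; have := cardsUI X Y.
  have := subset_leq_card (subsetT (X :|: Y)); rewrite cardsT card_ord; lia.
by exists a.
Qed.

(** * A single phase *)

Section Phase.

Variable k : nat.
Local Notation r := (3 * k).

(** Two quorums share an uncorrupted processor, which sent both the same preference. *)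
Lemma proposals_agree p q b c :
  proposal (st r.+1 p) = Some b -> proposal (st r.+1 q) = Some c -> b = c.
Proof.
rewrite !timed_atS !king_receive0 /=.
case: pickP => // b' pb [<-]; case: pickP => // c' pc [<-].
have [a aS] := large_sets_meet pb pc.
by rewrite inE !voterE // modnMr /= => /andP[/eqP[<-] /eqP[]].
Qed.

Lemma voted_proposal p b :
  t < #|voters (received r.+1 p) b| ->
  exists2 a, a \notin S & proposal (st r.+1 a) = Some b.
Proof.
case/many_voters_honest=> a aS; rewrite voterE // mod3S /= => /eqP pa.
by exists a.
Qed.

(** At least [n - 2 * t > t] of these votes come from uncorrupted processors, which send them to
    everybody. *)
Lemma strong_votes_spread p q b :
  n - t <= #|voters (received r.+1 p) b| -> t < #|voters (received r.+1 q) b|.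
Proof.
move=> strong; pose X := voters (received r.+1 p) b :\: S.
have : #|X| <= #|voters (received r.+1 q) b|.
  apply/subset_leq_card/subsetP => a; rewrite inE => /andP[aS].
  by rewrite !voterE.
have := cardsID S (voters (received r.+1 p) b).
have := subset_leq_card (subsetIr (voters (received r.+1 p) b) S).
rewrite -/X; lia.
Qed.

(** A value with more than [t] votes has an uncorrupted proposer, so either [pick] can only return
    [b]. *)
Lemma voted_preference p b :
  t < #|voters (received r.+1 p) b| -> preference (st r.+2 p) = b.
Proof.
move=> pb; have [a aS propa] := voted_proposal pb.
have same c : t < #|voters (received r.+1 p) c| -> c = b.
  by case/voted_proposal=> a' _ propa'; apply: proposals_agree propa' propa.
rewrite timed_atS /king_receive mod3S; case: pickP => [c strong|_] /=.
  by apply: same; lia.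
by case: pickP => [c|/(_ b)] /=; [exact: same | rewrite pb].
Qed.

Lemma locked_spread p q :
  locked (st r.+2 p) -> preference (st r.+2 q) = preference (st r.+2 p).
Proof.
rewrite [st r.+2 p]timed_atS /king_receive mod3S; case: pickP => [b strong _|_].
  by rewrite /=; apply/voted_preference/(strong_votes_spread _ strong).
by case: pickP.
Qed.

Lemma phase_end p : st r.+3 p =
  KingState
    (if locked (st r.+2 p) then preference (st r.+2 p)
     else if insub k is Some i then
       d r.+2 i p == Some (choice_message (Some true))
     else preference (st r.+2 p))
    (proposal (st r.+2 p)) (locked (st r.+2 p)).
Proof. by rewrite timed_atS {1}/king_receive mod3SS div3SS. Qed.

(** Unanimity yields [n - t] votes in both voting rounds, so everybody locks and no king can
    interfere. *)
Lemma unanimity_persists b :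
  (forall p, preference (st r p) = b) ->
  forall p, preference (st r.+3 p) = b.
Proof.
move=> all_b.
have proposed p : proposal (st r.+1 p) = Some b.
  rewrite timed_atS king_receive0 /=; case: pickP => [c strong|/(_ b)] /=.
    have [|a aS] := @many_voters_honest r p c; first by apply: leq_trans strong; lia.
    by rewrite voterE // modnMr /= all_b => /eqP[->].
  rewrite unanimous_voters // => a aS.
  by rewrite voterE // modnMr /= all_b.
have voted p : n - t <= #|voters (received r.+1 p) b|.
  by apply: unanimous_voters => a aS; rewrite voterE // mod3S /= proposed.
move=> p; have lock_p : locked (st r.+2 p).
  rewrite timed_atS /king_receive mod3S; case: pickP => // /(_ b) /=.
  by rewrite voted.
by rewrite phase_end /= lock_p; apply/voted_preference/(strong_votes_spread _ (voted p)).
Qed.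

End Phase.

(** Unlocked processors copy the king; locked ones share its preference by [locked_spread]. *)
Lemma good_king (k : 'I_n) p q :
  k \notin S -> preference (st (3 * k).+3 p) = preference (st (3 * k).+3 q).
Proof.
move=> kS; suff pk i : preference (st (3 * k).+3 i) = preference (st (3 * k).+2 k).
  by rewrite !pk.
rewrite phase_end /= valK; case: ifP => [lock_i|_].
  by rewrite (locked_spread k lock_i).
by rewrite reliable // /king_send mod3SS /=; case: (preference _).
Qed.

Lemma unanimity_forever b k m :
  k <= m -> (forall p, preference (st (3 * k) p) = b) ->
  forall p, preference (st (3 * m) p) = b.
Proof.
move=> le_km all_b; elim: m le_km => [|m IHm].
  by rewrite leqn0 => /eqP k0; rewrite k0 in all_b.
rewrite leq_eqVlt => /predU1P[<-//|/IHm all_m].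
by rewrite mulnS; apply: unanimity_persists.
Qed.

Lemma phase_king_consensus :
  consensus x (fun p => preference (st (3 * n) p)).
Proof.
split.
  by apply: disagreeing_or_constant => i b const; apply: (@unanimity_forever b 0).
have [|k kS] := exists_uncorrupted card_S; first by lia.
move=> i j; have same p : preference (st (3 * n) p) = preference (st (3 * k.+1) i).
  apply: (unanimity_forever (ltn_ord k)) => q; rewrite mulnS; exact: good_king.
by rewrite !same.
Qed.

End PhaseKing.

Lemma solvable_byzantine n t :
  3 * t < n -> solvable Byzantine (@stationary n t) (@consensus n).
Proof.
move=> small_t.
apply: (@timed_solvable n king_state king_init (@king_send n) (@king_receive n t)
  (3 * n) preference) => x F d [S cardS sFS] st ex; split=> //.
apply: (phase_king_consensus small_t cardS) => r p q pS.
by have := ex r p q; rewrite (negbTE (contra (subsetP (sFS r) p) pS)).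
Qed.

(** * Signed votes *)

(** The header holds the payload length, so an occurrence at the first position is the whole
    message. *)
Lemma infix_encode n (p p' : 'I_n) r r' m m' :
  infix (encode p' r' m') (encode p r m) ->
  [/\ p' = p, r' = r & m' = m] \/ infix (encode p' r' m') m.
Proof.
rewrite /encode /= => /orP[|inf]; last by right.
case/andP=> /eqP[/val_inj->] /andP[/eqP[->] /andP[/eqP[sz]]] pre; left; split=> //.
by apply/eqP; move: pre; rewrite prefixE sz take_size eq_sym.
Qed.

(** Bits contain no marker [None], so a triple can start only where a token does. *)
Lemma infix_flatten_tokens n (T : Type) (l : seq T) (p : T -> 'I_n) (r : T -> nat)
    (b : bool) (p' : 'I_n) r' m' :
  infix (encode p' r' m')
    (flatten [seq encode (p a) (r a) (bit_message b) | a <- l]) ->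
  exists2 i, i < size l & forall a0, let a := nth a0 l i in
    [/\ p' = p a, r' = r a & m' = bit_message b].
Proof.
elim: l => [|a l IHl] //=.
case/orP=> [|/IHl[i lti eqi]]; last by exists i.+1.
case/andP=> /eqP[/val_inj->] /andP[/eqP[->] /andP[/eqP[sz]]] pre; exists 0 => //= _.
by case: m' {IHl} sz pre => [|u [|//]] //= _ /andP[/eqP-> _].
Qed.

Section SignedVotes.

Variables (n t : nat).

Record vote_state := VoteState {
  own_input : bool;
  known : {set 'I_n * 'I_t.+2}
}.

(** This is exactly what [vote_send] emits for a positive vote, so direct and relayed votes are
    recognized alike. *)
Definition vote_token (a : 'I_n * 'I_t.+2) : message :=
  encode a.1 a.2.*2 (bit_message true).

Definition initial_voters (K : {set 'I_n * 'I_t.+2}) : {set 'I_n} :=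
  [set p | (p, ord0) \in K].

Definition later_voters (K : {set 'I_n * 'I_t.+2}) : {set 'I_n} :=
  [set p | [exists j : 'I_t.+2, (0 < j) && ((p, j) \in K)]].

Definition supports (j : nat) (s : vote_state) : bool :=
  if j == 0 then own_input s
  else (t < #|initial_voters (known s)|) && (j <= #|later_voters (known s)|.+1).

Definition vote_payload (r : nat) (s : vote_state) : message :=
  if odd r then flatten [seq vote_token a | a <- enum (known s)]
  else bit_message (supports r./2 s).

Definition vote_send (r : nat) (p : 'I_n) (s : vote_state) : message :=
  encode p r (vote_payload r s).

(** The guard [a.2.*2 <= r] discards votes dated in the future, which authenticity does not
    protect. *)
Definition vote_receive (r : nat) (s : vote_state) (f : 'I_n -> option message)
    : vote_state :=
  VoteState (own_input s)
    (known s :|: [set a : 'I_n * 'I_t.+2 | (a.2.*2 <= r) &&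
       [exists p, if f p is Some m then infix (vote_token a) m else false]]).

Definition vote_init (b : bool) := VoteState b set0.

Variables (x : 'I_n -> bool) (F : corruption_pattern n) (d : traffic n).

Local Notation st := (timed_at vote_init vote_receive x d).

Hypothesis uncorrupted_sends :
  forall r p q, p \notin F r -> d r p q = Some (vote_send r p (st r p)).
Hypothesis corrupted_authentic :
  forall r p q s, p \in F r -> d r p q = Some s -> authentic F d r p s.

(** * Known votes are not forged *)

Definition genuine (r : nat) (a : 'I_n * 'I_t.+2) : Prop :=
  a.2.*2 < r /\
  (a.1 \in F a.2.*2 \/
   a.1 \notin F a.2.*2 /\ exists q, d a.2.*2 a.1 q = Some (vote_token a)).

Lemma in_knownS r p a : (a \in known (st r.+1 p)) =
  (a \in known (st r p)) || (a.2.*2 <= r) &&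
    [exists q, if d r q p is Some m then infix (vote_token a) m else false].
Proof. by rewrite /= !inE. Qed.

Lemma known_receive r p a :
  a \in known (st r.+1 p) ->
  a \in known (st r p) \/
  a.2.*2 <= r /\ exists q s, d r q p = Some s /\ infix (vote_token a) s.
Proof.
rewrite in_knownS => /orP[|/andP[le_ar /existsP[q]]]; first by left.
case E: (d r q p) => [s|] // inf; right; split=> //.
by exists q, s.
Qed.

(** Half of an induction on rounds: a relay contains only known, hence genuine, votes, and a bit
    contains no triple. *)
Lemma sent_authentic r :
  (forall p a, a \in known (st r p) -> genuine r a) ->
  forall p q s, d r p q = Some s -> authentic F d r p s.
Proof.
move=> known_genuine p q s ds; have [pF|pF] := boolP (p \in F r).
  exact: corrupted_authentic pF ds.
move: ds; rewrite uncorrupted_sends // => -[<-].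
exists (vote_payload r (st r p)) => // p' r' m' le_r'r.
rewrite /vote_payload; case: ifP => [_|_ inf]; last first.
  by case/negP: (encode_notin_bit p' r' m' (supports r./2 (st r p))).
case/infix_flatten_tokens=> i lti; rewrite -cardE in lti.
case: (pickP (mem (known (st r p)))) => [a0 _|none]; last first.
  by move: lti; rewrite (eq_card0 none).
move=> /(_ a0) /= [-> -> ->].
have : nth a0 (enum (known (st r p))) i \in known (st r p).
  by rewrite -mem_enum mem_nth // -cardE.
by case/known_genuine.
Qed.

(** The other half: a new vote is either the received message itself or lies in its authentic
    payload. *)
Lemma known_genuine r p a : a \in known (st r p) -> genuine r a.
Proof.
elim: r p a => [|r IHr] p a; first by rewrite /= inE.
case/known_receive=> [/IHr[lt_ar gen]|[le_ar [q [s [ds inf]]]]].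
  by split=> //; apply: leqW.
split=> //; have [m sE real] := sent_authentic IHr ds.
move: inf; rewrite sE => /infix_encode[[eq_p eq_r eq_m]|inf]; last exact: real inf.
have [inF|ninF] := boolP (a.1 \in F a.2.*2); [by left | right; split=> //].
by exists p; rewrite /vote_token eq_p eq_r eq_m ds sE.
Qed.

Lemma all_authentic r p q s : d r p q = Some s -> authentic F d r p s.
Proof. exact: sent_authentic (@known_genuine r) p q s. Qed.

Lemma known_supports r p (a : 'I_n * 'I_t.+2) :
  a \in known (st r p) -> a.1 \notin F a.2.*2 ->
  supports a.2 (st a.2.*2 a.1).
Proof.
case/known_genuine=> _ [->//|[aF [q dq]]] _; move: dq.
rewrite uncorrupted_sends // /vote_send /vote_payload odd_double doubleK.
by case: (supports _ _).
Qed.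

Lemma known_leq r r' p : r <= r' -> known (st r p) \subset known (st r' p).
Proof.
elim: r' => [|r' IHr]; first by rewrite leqn0 => /eqP->.
rewrite leq_eqVlt => /predU1P[->//|/IHr sub].
exact: subset_trans sub (subsetUl _ _).
Qed.

Lemma learn_directly h (j : 'I_t.+2) p :
  h \notin F j.*2 -> supports j (st j.*2 h) -> (h, j) \in known (st j.*2.+1 p).
Proof.
move=> hF sup; rewrite in_knownS leqnn; apply/orP; right; apply/existsP; exists h.
rewrite uncorrupted_sends // /vote_send /vote_payload odd_double doubleK sup.
exact: infix_refl.
Qed.

Lemma learn_by_relay h j p :
  h \notin F j.*2.+1 -> known (st j.*2.+1 h) \subset known (st j.*2.+2 p).
Proof.
move=> hF; apply/subsetP => a aK; rewrite in_knownS.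
(* Known votes are old enough to pass the date guard of [vote_receive]. *)
have [lt_a _] := known_genuine aK; rewrite (ltnW lt_a); apply/orP; right.
have inf : infix (vote_token a)
    (flatten [seq vote_token a | a <- enum (known (st j.*2.+1 h))]).
  have : a \in enum (known (st j.*2.+1 h)) by rewrite mem_enum.
  by case/splitPr=> l1 l2; rewrite map_cat flatten_cat; apply: infix_infix.
apply/existsP; exists h; rewrite uncorrupted_sends // /vote_send /vote_payload.
by rewrite oddS odd_double; apply: infix_catl inf.
Qed.

(** * Propagation of support and agreement *)

Variable S : {set 'I_n}.
Hypothesis corrupted_in_S : forall r, F r \subset S.
Hypothesis card_S : #|S| <= t.
Hypothesis small_t : 2 * t < n.

Local Notation supporting j p := (supports j (st j.*2 p)).

Lemma uncorrupted r p : p \notin S -> p \notin F r.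
Proof. exact: contra (subsetP (corrupted_in_S r) p). Qed.

Lemma initial_voters_mono (K K' : {set 'I_n * 'I_t.+2}) :
  K \subset K' -> initial_voters K \subset initial_voters K'.
Proof. by move=> sKK'; apply/subsetP => p; rewrite !inE; apply: subsetP. Qed.

Lemma later_voters_mono (K K' : {set 'I_n * 'I_t.+2}) :
  K \subset K' -> later_voters K \subset later_voters K'.
Proof.
move=> sKK'; apply/subsetP => p; rewrite !inE => /existsP[j /andP[gt0j Kj]].
by apply/existsP; exists j; rewrite gt0j (subsetP sKK').
Qed.

Lemma card_uncorrupted : t < #|~: S|.
Proof. have := cardsC S; rewrite card_ord; lia. Qed.

Lemma supporting_later j p : 0 < j -> supporting j p ->
  t < #|initial_voters (known (st j.*2 p))| /\
  j <= #|later_voters (known (st j.*2 p))|.+1.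
Proof. by case: j => // j _ /andP[]. Qed.

(** More than [t] uncorrupted processors vote in phase [j], while phase [j.+1] asks for only
    [j <= t.+1] later voters. *)
Lemma unanimous_support j :
  j < t.+2 -> 0 < j -> (forall p, supporting j p) -> forall p, supporting j.+1 p.
Proof.
move=> lt_j gt0j all_j p; have [init_p _] := supporting_later gt0j (all_j p).
have sub : known (st j.*2 p) \subset known (st j.+1.*2 p).
  by apply: known_leq; lia.
rewrite /supports /=; apply/andP; split.
  exact: leq_trans init_p (subset_leq_card (initial_voters_mono sub)).
rewrite ltnS -ltnS; apply: (leq_trans (n := t.+2)) => //; rewrite ltnS.
apply: leq_trans card_uncorrupted _; apply/subset_leq_card/subsetP => h.
rewrite inE => hS; rewrite inE; apply/existsP; exists (Ordinal lt_j); rewrite gt0j andTb.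
have le2 : j.*2.+1 <= j.+1.*2 by rewrite doubleS.
apply: (subsetP (known_leq p le2)).
exact: (@learn_directly h (Ordinal lt_j) p (uncorrupted _ hS) (all_j h)).
Qed.

(* The earlier later-phase votes known to the first uncorrupted supporter are
   all from [S]; relaying them with its own vote makes up one vote more. *)
Lemma first_support j h :
  j < t.+2 -> 0 < j -> h \notin S -> supporting j h ->
  (forall i h', 0 < i -> i < j -> h' \notin S -> ~~ supporting i h') ->
  forall p, supporting j.+1 p.
Proof.
move=> lt_j gt0j hS sup_h first p; have [init_h later_h] := supporting_later gt0j sup_h.
have sub1 : known (st j.*2.+1 h) \subset known (st j.+1.*2 p).
  by rewrite doubleS; apply: learn_by_relay (uncorrupted _ hS).
have sub : known (st j.*2 h) \subset known (st j.+1.*2 p).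
  by apply: subset_trans sub1; apply: known_leq.
have own : (h, Ordinal lt_j) \in known (st j.+1.*2 p).
  apply: (subsetP sub1).
  exact: (@learn_directly h (Ordinal lt_j) h (uncorrupted _ hS) sup_h).
have in_S : later_voters (known (st j.*2 h)) \subset S.
  apply/subsetP => a; rewrite inE => /existsP[i /andP[gt0i Ka]].
  apply/negPn/negP => aS; have [lt_ij _] := known_genuine Ka.
  have /negP[] : ~~ supporting i a by apply: first; rewrite ?ltn_double // in lt_ij *.
  exact: (known_supports Ka (uncorrupted _ aS)).
rewrite /supports /=; apply/andP; split.
  exact: leq_trans init_h (subset_leq_card (initial_voters_mono sub)).
rewrite ltnS; apply: leq_trans later_h _.
have <- : #|h |: later_voters (known (st j.*2 h))| =
    #|later_voters (known (st j.*2 h))|.+1.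
  by rewrite cardsU1 (contra (subsetP in_S h)).
apply/subset_leq_card; rewrite subUset later_voters_mono // andbT sub1set inE.
by apply/existsP; exists (Ordinal lt_j); rewrite gt0j.
Qed.

Lemma support_forever j m : 0 < j -> j <= m -> m <= t.+2 ->
  (forall p, supporting j p) -> forall p, supporting m p.
Proof.
move=> gt0j; elim: m => [|m IHm]; first by lia.
rewrite leq_eqVlt => /predU1P[<-//|le_jm] lt_m all_j.
by apply: unanimous_support => //; [lia | apply: IHm => //; lia].
Qed.

(** Phase [t.+2] requires [t.+1] later voters, one of them uncorrupted. So the least phase with an
    uncorrupted supporter precedes [t.+2], which leaves time for [first_support]. *)
Lemma support_agreement p q : supporting t.+2 p -> supporting t.+2 q.
Proof.
move=> sup_p; have [_ later_p] := @supporting_later t.+2 p isT sup_p.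
have /subsetPn[h] : ~~ (later_voters (known (st t.+2.*2 p)) \subset S).
  by apply/negP => /subset_leq_card; lia.
rewrite inE => /existsP[j /andP[gt0j Kh]] hS.
pose Q j := (0 < j) && (j < t.+2) && [exists h, (h \notin S) && supporting j h].
have exQ : exists j, Q j.
  exists j; rewrite /Q gt0j ltn_ord; apply/existsP; exists h; rewrite hS.
  exact: (known_supports Kh (uncorrupted _ hS)).
case: (ex_minnP exQ) => i /andP[/andP[gt0i lt_i] /existsP[h' /andP[h'S sup_h']]] min_i.
apply: (@support_forever i.+1) => //.
apply: (first_support lt_i gt0i h'S sup_h') => k a gt0k lt_ki aS; apply/negP => sup_a.
have : i <= k; last by rewrite leqNgt lt_ki.
apply: min_i; rewrite /Q gt0k (ltn_trans lt_ki lt_i).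
by apply/existsP; exists a; rewrite aS.
Qed.

Lemma signed_votes_consensus :
  consensus x (fun p => supports t.+2 (st t.+2.*2 p)).
Proof.
have own r p : own_input (st r p) = x p by elim: r => [|r IHr].
split; last by move=> p q; apply/idP/idP; exact: support_agreement.
apply: disagreeing_or_constant => p b const; case: b const => const.
  (* All inputs [true]: phase 1 asks for no later vote, and the uncorrupted initial votes
     suffice. *)
  apply: (@support_forever 1) => // q; rewrite /supports /= andbT.
  apply: leq_trans card_uncorrupted _; apply/subset_leq_card/subsetP => h.
  rewrite inE => hS; rewrite inE.
  apply: (subsetP (known_leq q (isT : 1 <= 1.*2))).
  apply: (@learn_directly h ord0 q); first exact: uncorrupted.
  by rewrite /supports /= const.
(* All inputs [false]: more than [t] initial votes would include one of an uncorrupted processor. *)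
apply/negP => sup_p; have [init_p _] := @supporting_later t.+2 p isT sup_p.
have /subsetPn[h] : ~~ (initial_voters (known (st t.+2.*2 p)) \subset S).
  by apply/negP => /subset_leq_card; lia.
rewrite inE => Kh hS; have := known_supports Kh (uncorrupted _ hS).
by rewrite /supports /= const.
Qed.

End SignedVotes.

Lemma solvable_auth n t :
  2 * t < n -> solvable AuthByzantine (@stationary n t) (@consensus n).
Proof.
move=> small_t.
apply: (@timed_solvable n (vote_state n t) (@vote_init n t) (@vote_send n t)
  (@vote_receive n t) t.+2.*2 (@supports n t t.+2)) => x F d [S cardS sFS] st ex.
have sends r p q : p \notin F r -> d r p q = Some (vote_send r p (st r p)).
  by move=> pF; have := ex r p q; rewrite (negbTE pF).
have auth r p q s : p \in F r -> d r p q = Some s -> authentic F d r p s.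
  by move=> pF; have := ex r p q; rewrite pF; apply.
split; first exact: all_authentic sends auth.
exact: (signed_votes_consensus sends auth sFS cardS small_t).
Qed.

Theorem theorem3p1 (n t : nat) (tau : corruption) :
  solvable tau (@mobile n t) (@commit_adopt n) ->
  solvable tau (@stationary n t) (@consensus n).
Proof.
(* The bounds on [t] rest on two processors with different inputs. *)
have [le_n1 _|gt1n] := leqP n 1; first exact: solvable_alone.
case: tau => solv.
- exact: solvable_omission (omission_bound gt1n solv).
- exact: solvable_byzantine (byzantine_bound gt1n solv).
- exact: solvable_auth (auth_bound gt1n solv).
Qed.
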